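(* There is a constant $\kappa_0>0$ depending only on the critical order $\ell$ such that the following holds. Suppose that $f\in\mathcal{A}_*$ (with critical order $\ell$) has special combinatorics. Then for any sufficiently small open cover $\mathcal{U}$ of the Cantor set $\omega(c)$ (i.e. there is $\delta=\delta(f)>0$ such that this holds for every open cover $\mathcal U$ of $\omega(c)$ all of whose elements have diameter less than $\delta$), the topological complexity function satisfies $$p(\mathcal{U},n+1)\ge\kappa_0 n\quad\text{for all } n \text{ large enough}.$$
   Context: A continuous map $f:[0,1]\to[0,1]$ is unimodal if there is a unique $c\in(0,1)$ (the critical point) such that $f$ is strictly increasing on $[0,c]$ and strictly decreasing on $[c,1]$. $\mathcal{A}$ denotes the collection of unimodal maps $f$ that are $C^3$ outside $c$, satisfy $f'(x)\ne 0$ for $x\neq c$, and have $c$ non-flat: there exist $C^3$ local diffeomorphisms $\phi,\psi$ defined near $0$ with $\phi(0)=c$, $\psi(0)=f(c)$, and a real number $\ell>1$ (the order of $c$) such that $|\psi^{-1}\circ f\circ\phi(x)|=|x|^{\ell}$ for $|x|$ small. $\mathcal{A}_*$ is the collection of $f\in\mathcal{A}$ all of whose periodic points are hyperbolic repelling. Standing normalization: $f(0)=f(1)=0$, and $f$ is geometrically symmetric near $c$, i.e. $f(c+x)=f(c-x)$ for $|x|$ small. For $T\subset[0,1]$, $\mathrm{D}(T)=\{x\in[0,1]:f^k(x)\in T\text{ for some }k\ge1\}$; components of $\mathrm{D}(T)\cap T$ are the return domains of $T$. An open set $T\subset[0,1]$ is nice if $f^n(\partial T)\cap T=\emptyset$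 for all $n\ge0$ and $T$ contains no fixed point of $f$. A nice interval $T\ni c$ is symmetric if $f(\partial T)$ is a single point. $f\in\mathcal{A}_*$ has special combinatorics if $\omega(c)\ni c$ is minimal and there exists a symmetric nice interval $Y\ni c$ such that, setting $Y_0=Y$ and letting $Y_{n+1}$ be the return domain of $Y_n$ containing $c$, for each $n=0,1,\ldots$ the set $Y_n\setminus Y_{n+1}$ has exactly one component intersecting $\omega(c)$. For an open cover $\mathcal{U}$ of $\omega(c)$, $N(\mathcal{U})$ is the minimal cardinality of a subcover; $\mathcal{U}\bigvee\mathcal{V}=\{U\cap V:U\in\mathcal{U},V\in\mathcal{V}\}$; $p(\mathcal{U},n)=N\big(\bigvee_{i=0}^{n-1}f^{-i}\mathcal{U}\big)$. *)

(* Defs.v *)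
From HB Require Import structures.
From mathcomp Require Import all_boot all_order all_algebra.
From mathcomp Require Import all_classical all_reals all_analysis.

Set Implicit Arguments.
Unset Strict Implicit.
Unset Printing Implicit Defensive.

Import Order.TTheory GRing.Theory Num.Theory.
Import numFieldNormedType.Exports.
Local Open Scope classical_set_scope.
Local Open Scope ring_scope.

(* A self-map of [0, 1] is represented by a function f : R -> R mapping [0, 1]
   into itself; its values outside [0, 1] are never used. *)

Section Smoothness.
Context {R : realType}.
Implicit Types (A : set R) (f g : R -> R) (a b x d : R).

(* Derivative along A: two-sided at interior points of A, one-sided at an
   endpoint of A that belongs to A. *)
Definition is_derive_in A f x d :=
  (fun y => (f y - f x) / (y - x)) @ within A x^' --> d.

Fixpoint Cn_in (n : nat) A f : Prop :=
  if n is m.+1 then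
    exists g, (forall x, A x -> is_derive_in A f x (g x)) /\ Cn_in m A g
  else {within A, continuous f}.

(* phi is a C^3 diffeomorphism from a neighbourhood of a onto a neighbourhood
   of b = phi a, with inverse phi'. *)
Definition local_C3_diffeo (phi phi' : R -> R) a b :=
  exists U V : set R,
    [/\ open_nbhs a U, open_nbhs b V & phi a = b] /\
    [/\ set_bij U V phi, {in U, cancel phi phi'}, Cn_in 3 U phi
      & Cn_in 3 V phi'].

End Smoothness.

Section UnimodalMaps.
Context {R : realType}.
Implicit Types (f : R -> R) (c l p : R).

Local Notation I01 := (`[0, 1]%classic : set R).

(* The strict monotonicity conditions determine c, so no uniqueness clause is
   needed. *)
Definition unimodal f c :=
  [/\ f @` I01 `<=` I01, {within I01, continuous f} & 0 < c < 1] /\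
  {in `[0, c] &, {homo f : x y / x < y}} /\
  {in `[c, 1] &, {homo f : x y /~ x < y}}.

Definition nonflat_of_order f c l :=
  1 < l /\
  exists phi phi' psi psi' : R -> R,
    [/\ local_C3_diffeo phi phi' 0 c, local_C3_diffeo psi psi' 0 (f c)
      & \forall x \near 0, `|psi' (f (phi x))| = `|x| `^ l].

Definition normalized f c :=
  [/\ f 0 = 0, f 1 = 0 & \forall x \near (0 : R), f (c + x) = f (c - x)].

Definition classA f c l :=
  [/\ unimodal f c,
      Cn_in 3 (I01 `\ c) f,
      (forall x d, I01 x -> x <> c -> is_derive_in I01 f x d -> d <> 0),
      nonflat_of_order f c l
    & normalized f c].

Definition has_period f (n : nat) p :=
  [/\ (0 < n)%N, iter n f p = p
    & forall m, (0 < m < n)%N -> iter m f p <> p].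

Definition hyperbolic_repelling f (n : nat) p :=
  exists2 d, is_derive_in I01 (iter n f) p d & 1 < `|d|.

Definition classA_star f c l :=
  classA f c l /\
  forall n p, I01 p -> has_period f n p -> hyperbolic_repelling f n p.

End UnimodalMaps.

Section SpecialCombinatorics.
Context {R : realType}.
Implicit Types (f : R -> R) (c x : R) (T A C K : set R).

Local Notation I01 := (`[0, 1]%classic : set R).

Definition omega_limit f x : set R :=
  cluster ((fun n => iter n f x) @ \oo).

Definition minimal_set f K :=
  [/\ K !=set0, closed K, f @` K `<=` K
    & forall L : set R, L !=set0 -> closed L -> f @` L `<=` L -> L `<=` K ->
        L = K].

Definition component A C := exists2 x, A x & C = connected_component A x.

Definition entry_domain f T : set R :=
  [set x | I01 x /\ exists2 k, (0 < k)%N & T (iter k f x)].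

(* This is empty when c is not in entry_domain f T `&` T. *)
Definition central_return_domain f c T : set R :=
  connected_component (entry_domain f T `&` T) c.

(* Openness is relative to the space [0, 1]. *)
Definition open01 T := exists2 O : set R, open O & T = O `&` I01.

(* For a set T that is open in the space [0, 1], this is its boundary in that
   space. *)
Definition boundary01 T : set R := closure T `\` T.

Definition nice f T :=
  [/\ open01 T,
      (forall n, (iter n f @` boundary01 T) `&` T = set0)
    & forall x, T x -> f x <> x].

Definition symmetric_nice_interval f c T :=
  [/\ nice f T, is_interval T, T c
    & exists y, f @` boundary01 T = [set y]].

Definition special_combinatorics f c :=
  [/\ omega_limit f c c, minimal_set f (omega_limit f c)
    & exists2 Y, symmetric_nice_interval f c Y &
        let Yn n := iter n (central_return_domain f c) Y in
        forall n, exists! C,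
          component (Yn n `\` Yn n.+1) C /\ C `&` omega_limit f c !=set0].

End SpecialCombinatorics.

Section Complexity.
Context {R : realType}.
Implicit Types (f : R -> R) (A K : set R) (U V W : set (set R)).

(* Covers of K by subsets of K that are open in the subspace K. *)
Definition open_cover K U :=
  (forall A, U A -> exists2 O : set R, open O & A = K `&` O) /\
  \bigcup_(A in U) A = K.

Definition diam A : R := sup [set `|x - y| | x in A & y in A].

Definition has_subcover_of_card K U (n : nat) :=
  exists V, [/\ V `<=` U, (V #= `I_n)%card & K `<=` \bigcup_(A in V) A].

(* The default value 0 is only reached when U has no finite subcover. *)
Definition subcover_number K U : nat :=
  xget 0%N [set n | has_subcover_of_card K U n /\
                    forall m, has_subcover_of_card K U m -> (n <= m)%N].

Definition cover_join U V : set (set R) := [set A `&` B | A in U & B in V].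

(* Preimage under the i-th iterate of the restriction of f to K. *)
Definition cover_preimage f K (i : nat) U : set (set R) :=
  [set K `&` iter i f @^-1` A | A in U].

(* The trivial cover [set setT] is neutral for cover_join. *)
Definition complexity f K U (n : nat) : nat :=
  subcover_number K
    (\big[cover_join/[set setT]]_(0 <= i < n) cover_preimage f K i U).

End Complexity.

(* Main.v *)
Require Import Defs.
From HB Require Import structures.
From mathcomp Require Import all_boot all_order all_algebra.
From mathcomp Require Import all_classical all_reals all_analysis.
From mathcomp Require Import finmap zify lra.
Import Order.TTheory GRing.Theory Num.Theory.
Import numFieldNormedType.Exports.
Local Open Scope classical_set_scope.
Local Open Scope ring_scope.

(* Label a point of omega(c) by its position relative to Y: left of Y, in Y, or
   right of Y. No boundary point of Y lies in omega(c), because its orbit avoids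
   Y while omega(c) is minimal and contains c; hence points of omega(c) that are
   delta-close have equal labels, and if all elements of a cover have diameter
   less than delta, then each element of its n-th iterated join carries a single
   word of n labels. So p(U, n) is at least the number of words of length n, and
   by Morse-Hedlund that number is at least n + 1 as soon as there are infinitely
   many itineraries. Special combinatorics provides them: each shell
   Y_n \ Y_{n+1} meets omega(c), on one side of c only, and points of omega(c) in
   different shells have different itineraries. Hence
   kappa_0 = 1 works. *)

(** [g] chooses a cover element for each point. Points with distinct words get distinct elements, so
    [s] injects into [V]. *)
Lemma uniq_map_card_le {S : eqType} {T : Type} {N : eqType} {K : set S}
    {V : set T} {word : S -> N} {g : S -> T} {s : seq S} {m : nat} :
  (V #= `I_m)%card -> (forall x, K x -> V (g x)) ->
  (forall x y, K x -> K y -> g x = g y -> word x = word y) ->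
  (forall x, x \in s -> K x) -> uniq (map word s) -> (size s <= m)%N.
Proof.
move=> Vm gV gw sK us.
case: s => [//|x0 s0] in sK us *; set s := x0 :: s0 in sK us *.
have sin i : (i < size s)%N -> K (nth x0 s i) by move=> ilt; apply/sK/mem_nth.
rewrite -card_le_II -(card_le_eqr Vm).
have ginj : {in `I_(size s) &, injective (fun i => g (nth x0 s i))}.
  move=> i j /set_mem /= ilt /set_mem /= jlt gij.
  have wij := gw _ _ (sin _ ilt) (sin _ jlt) gij.
  apply/eqP; rewrite -(nth_uniq (word x0) _ _ us) ?size_map //.
  by rewrite !(nth_map x0) // wij.
rewrite -(card_le_eql (inj_card_eq ginj)).
by apply: subset_card_le => _ [i /= ilt <-]; apply/gV/sin.
Qed.

Lemma uniq_map_inj_in {S N : eqType} {h : S -> N} {s : seq S} :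
  uniq (map h s) -> {in s &, injective h}.
Proof.
move=> us x y xs ys e; have [ix iy] : (index x s < size s /\ index y s < size s)%N.
  by rewrite !index_mem.
rewrite -(nth_index x xs) -(nth_index x ys); congr nth.
apply/eqP; rewrite -(nth_uniq (h x) _ _ us) ?size_map //.
by rewrite !(nth_map x) // !nth_index // e.
Qed.

(** * Symbolic dynamics: counting words of itineraries *)

Section MorseHedlund.
Context {T L : eqType} (f : T -> T) (K : set T) (lab : T -> L).
Hypothesis fK : forall x, K x -> K (f x).

Definition word (n : nat) (x : T) : seq L :=
  mkseq (fun i => lab (iter i f x)) n.

Lemma wordS n x : word n.+1 x = lab x :: word n (f x).
Proof.
rewrite /word /mkseq /= -[1%N]/(1 + 0)%N iotaDl -map_comp; congr cons.
by apply: eq_map => i /=; rewrite -iterSr.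
Qed.

Lemma word_rcons n x : word n.+1 x = rcons (word n x) (lab (iter n f x)).
Proof. by rewrite /word /mkseq -addn1 iotaD map_cat cats1. Qed.

Lemma word_eqP {n x y} : word n x = word n y <->
  (forall i, (i < n)%N -> lab (iter i f x) = lab (iter i f y)).
Proof.
split=> [e i ilt|e].
  by have := congr1 (fun s => nth (lab x) s i) e; rewrite !nth_mkseq.
apply: (@eq_from_nth _ (lab x)); rewrite !size_mkseq // => i ilt.
by rewrite !nth_mkseq // e.
Qed.

(** Dropping the first letter of two equal words of length [n.+1] leaves equal words of length [n]
    at [f x] and [f y], so the argument repeats. *)
Lemma word_determined {n} :
  (forall x y, K x -> K y -> word n x = word n y -> word n.+1 x = word n.+1 y) ->
  forall m x y, K x -> K y -> word n x = word n y -> word m x = word m y.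
Proof.
move=> H; elim=> [//|m IH] x y Kx Ky e.
have := H x y Kx Ky e; rewrite !wordS => -[-> e'].
by congr cons; apply: IH => //; apply: fK.
Qed.

(* Morse-Hedlund: if the number of words does not grow from length n to length
   n + 1, then the words of length n determine the itineraries, so that there
   are finitely many itineraries. *)
Lemma morse_hedlund (z : nat -> T) :
  (forall i, K (z i)) ->
  (forall i j, (i < j)%N ->
     exists k, lab (iter k f (z i)) <> lab (iter k f (z j))) ->
  forall n, exists s : seq T, [/\ size s = n.+1,
    forall x, x \in s -> K x & uniq (map (word n) s)].
Proof.
move=> zK zsep; elim=> [|n [s [ss sK us]]].
  by exists [:: z 0%N]; split => // x; rewrite inE => /eqP ->.
have word_prefix x y : word n.+1 x = word n.+1 y -> word n x = word n y.
  by rewrite !word_rcons => /rcons_inj[].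
have uS : uniq (map (word n.+1) s).
  apply: (map_uniq (f := fun w => take n w)); rewrite -map_comp.
  rewrite (_ : map _ s = map (word n) s) //.
  by apply: eq_map => x /=; rewrite word_rcons -cats1 take_size_cat ?size_mkseq.
(* Either a point with a new word extends [s], or the words of [s] exhaust those of length
   [n.+1]. *)
have [[x [Kx xs]]|nex] :=
    pselect (exists x, K x /\ word n.+1 x \notin map (word n.+1) s).
  exists (x :: s); split => /=; [by rewrite ss| |by rewrite xs].
  by move=> y; rewrite inE => /predU1P[->//|/sK].
have allin x : K x -> exists2 y, y \in s & word n.+1 x = word n.+1 y.
  move=> Kx; apply/mapP/negPn/negP => xs; by apply: nex; exists x.
have det x y : K x -> K y -> word n x = word n y -> word n.+1 x = word n.+1 y.
  move=> Kx Ky e.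
  have [x' x's ex] := allin x Kx; have [y' y's ey] := allin y Ky.
  rewrite ex ey; congr (word _ _); apply: (uniq_map_inj_in us) => //.
  by rewrite -(word_prefix _ _ ex) -(word_prefix _ _ ey).
(* Pigeonhole: [n.+2] points with pairwise distinct itineraries would have distinct words among only
   [n.+1]. *)
have zs : {subset map (word n) (map z (iota 0 n.+2)) <= map (word n) s}.
  move=> _ /mapP[_ /mapP[i _ ->] ->]; have [y ys e] := allin _ (zK i).
  by apply/mapP; exists y => //; apply: word_prefix.
have : uniq (map (word n) (map z (iota 0 n.+2))).
  rewrite -map_comp map_inj_uniq ?iota_uniq // => i j /= e.
  have H m := word_determined det m _ _ (zK i) (zK j) e.
  case: (ltngtP i j) => [/zsep|/zsep|->//] [k []].
    by have /word_eqP := H k.+1; apply.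
  by apply/esym; have /word_eqP := H k.+1; apply.
by move=> /uniq_leq_size/(_ zs); rewrite !size_map size_iota ss ltnn.
Qed.
End MorseHedlund.

(** * Word counts as lower bounds for the complexity of a cover *)

Section CoverComplexity.
Context {R : realType} (f : R -> R) (K : set R) (U : set (set R)).
Hypothesis fK : forall x, K x -> K (f x).
Hypothesis Kc : compact K.
Hypothesis Ucov : open_cover K U.

Local Notation iterated_cover n :=
  (\big[cover_join/[set setT]]_(0 <= i < n) cover_preimage f K i U).

Lemma finite_subcover : exists2 V, finite_set V &
  V `<=` U /\ K `<=` \bigcup_(A in V) A.
Proof.
have [Uo UK] := Ucov.
have := Kc; rewrite compact_cover.
(* Elements of [U] are open only relative to [K], so compactness is applied to the ambient open sets
   that induce them. *)
move=> /(_ _ [set O | open O /\ U (K `&` O)] id) [G [oG _] //|x Kx|D DU KD].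
  have [A UA Ax] : (\bigcup_(A in U) A) x by rewrite UK.
  have [G oG AE] := Uo _ UA.
  by exists G; [split => //; rewrite -AE|move: Ax; rewrite AE => -[]].
exists [set K `&` O | O in [set` D]]; first exact/finite_image/finite_fset.
split=> [_ [G /= GD <-]|x Kx]; first by have := DU _ GD => /set_mem[].
by have [G /= GD Ox] := KD _ Kx; exists (K `&` G) => //; exists G.
Qed.

Lemma iterated_cover_finite n : exists2 V, finite_set V &
  V `<=` iterated_cover n /\ K `<=` \bigcup_(A in V) A.
Proof.
rewrite /index_iota; elim: (iota _ _) => [|i r [V Vf [VU KV]]].
  rewrite big_nil; exists [set setT]; first exact: finite_set1.
  by split => // x _; exists setT.
rewrite big_cons /=; have [W Wf [WU KW]] := finite_subcover.
pose W' := cover_preimage f K i W.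
exists (cover_join W' V).
  by apply: finite_image2 => //; apply: finite_image.
split=> [_ [_ [A WA <-] [B VB <-]]|x Kx].
  exists (K `&` iter i f @^-1` A); first by exists A => //; exact: WU.
  by exists B => //; exact: VU.
have iK : K (iter i f x) by elim: i {W'} => //= i; exact: fK.
have [A WA Ax] := KW _ iK; have [B VB Bx] := KV _ Kx.
exists ((K `&` iter i f @^-1` A) `&` B) => //.
by exists (K `&` iter i f @^-1` A); [exists A|exists B].
Qed.

Lemma iterated_coverP n A : iterated_cover n A ->
  forall i, (i < n)%N -> exists2 B, U B & A `<=` iter i f @^-1` B.
Proof.
move=> An i ilt; have {ilt} : i \in index_iota 0 n by rewrite mem_index_iota.
elim: (index_iota _ _) A An => // j r IH A; rewrite big_cons /= inE.
move=> [_ [B UB <-] [C rC <-]] /predU1P[->|ir].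
  by exists B => // x [[]].
by have [D UD CD] := IH _ rC ir; exists D => // x [_ /CD].
Qed.

Lemma complexity_ge {N : eqType} (lab : R -> N) (n : nat) (s : seq R) :
  (forall A, U A -> forall x y, A x -> A y -> lab x = lab y) ->
  (forall x, x \in s -> K x) -> uniq (map (word f lab n) s) ->
  (size s <= complexity f K U n)%N.
Proof.
move=> Ulab sK us; rewrite /complexity /subcover_number.
set W := iterated_cover n.
have sub_le m : has_subcover_of_card K W m -> (size s <= m)%N.
  move=> [V [VW Vm KV]].
  (* The choice must be total on [R]; outside [K] the set is a dummy. *)
  have VP x : {A | K x -> V A /\ A x}.
    apply: cid; have [Kx|nKx] := pselect (K x); last by exists set0.
    by have [A VA Ax] := KV _ Kx; exists A.
  apply: (@uniq_map_card_le _ _ _ K V (word f lab n) (fun x => projT1 (VP x))) => //.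
    by move=> x Kx; have [] := projT2 (VP x) Kx.
  move=> x y Kx Ky e; have [VA Ax] := projT2 (VP x) Kx.
  have [_ Ay] := projT2 (VP y) Ky.
  rewrite -e in Ay; set A := projT1 (VP x) in VA Ax Ay.
  apply/word_eqP => i ilt; have [B UB AB] := iterated_coverP _ _ (VW _ VA) i ilt.
  by apply: (Ulab _ UB); apply: AB.
have hP : exists m, `[< has_subcover_of_card K W m >].
  have [V [m Vm] [VW KV]] := iterated_cover_finite n.
  by exists m; apply/asboolP; exists V.
(* A least subcover size exists because a finite subcover does; so [xget] does not return its
   default 0, which would break the bound. *)
suff /(xgetPex 0%N)[/sub_le] : exists k, has_subcover_of_card K W k /\
    forall j, has_subcover_of_card K W j -> (k <= j)%N by [].
case: (ex_minnP hP) => k /asboolP hk kmin.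
by exists k; split => // j /asboolP; apply: kmin.
Qed.
End CoverComplexity.

(** * Uniform local constancy of the position label *)

Section Separation.
Context {R : realType}.
Local Notation I01 := (`[0, 1]%classic : set R).

(* For an interval Y containing c, the value Some b tells on which side of Y the
   point x lies. *)
Definition position (Y : set R) (c x : R) : option bool :=
  if x \in Y then None else Some (x < c).

Lemma position_in {Y : set R} {c x y : R} :
  position Y c x = position Y c y -> Y x -> Y y.
Proof. by rewrite /position => + Yx; rewrite mem_set //; case: ifP => // /set_mem. Qed.

Lemma positionNin {Y : set R} {c x y : R} :
  position Y c x = position Y c y -> ~ Y x -> (x < c) = (y < c).
Proof. by rewrite /position => + Yx; rewrite memNset //; case: ifP => // _ [->]. Qed.

Lemma position_uniform (Y K : set R) (c : R) :
  open01 Y -> K `<=` I01 -> compact K -> Y c -> boundary01 Y `&` K = set0 ->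
  exists2 e, 0 < e & forall x y, K x -> K y -> `|x - y| < e ->
    position Y c x = position Y c y.
Proof.
move=> [G oG YE] KI Kc Yc BK.
have loc x : K x -> exists2 r, 0 < r &
    forall y, K y -> `|x - y| < r -> position Y c y = position Y c x.
  move=> Kx; have [Yx|nYx] := pselect (Y x).
    have : nbhs x G by apply: open_nbhs_nbhs; split => //; move: Yx; rewrite YE => -[].
    move=> /nbhs_ballP[r /= r0 rG]; exists r => // y Ky xy.
    rewrite /position !mem_set // YE; split; [exact: rG|exact: KI].
  have : nbhs x (~` closure Y).
    apply: open_nbhs_nbhs; split; first exact/closed_openC/closed_closure.
    move=> cYx; suff : (boundary01 Y `&` K) x by rewrite BK.
    by [].
  move=> /nbhs_ballP[r /= r0 rY].
  have xc : x != c by apply: contra_not_neq nYx => ->.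
  (* Radius [r] keeps [y] outside [Y]; radius [|x - c|] keeps it on the same side of [c]. *)
  exists (Num.min r `|x - c|); first by rewrite lt_min r0 normr_gt0 subr_eq0.
  move=> y Ky; rewrite lt_min => /andP[xyr xyc].
  rewrite /position (memNset nYx) memNset; last first.
    by move=> Yy; apply: (rY y) => //; exact: subset_closure.
  congr Some; apply/idP/idP => ?; rewrite ltNge; apply/negP => ?; move: xyc;
    by case: (ler0P (x - y)); case: (ler0P (x - c)); lra.
have := Kc => /compact_near_coveringP /(_ R 0^'+
  (fun e x => K x -> forall y, K y -> `|x - y| < e ->
    position Y c x = position Y c y) _) [x Kx|e /= e0 eP].
  have [r r0 rP] := loc x Kx.
  exists (ball x (r / 2), [set e | e < r / 2]) => /=.
    by split; [apply: nbhsx_ballx|apply: nbhs_right_lt]; rewrite divr_gt0.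
  move=> [x' e] /= [xx' er] Kx' y Ky xy.
  rewrite /ball /= in xx'.
  rewrite (rP x') ?(rP y) //; last by move: xx'; lra.
  have := ler_distD x' x y; lra.
exists (e / 2); first by rewrite divr_gt0.
move=> x y Kx Ky; apply: (eP (e / 2)) => //=; last by rewrite divr_gt0.
by rewrite sub0r normrN gtr0_norm ?divr_gt0 //; move: e0; lra.
Qed.
End Separation.

(** * Order and intermediate values on the two branches of a unimodal map *)

Section Unimodal.
Context {R : realType} (f : R -> R) (c : R).
Hypothesis fu : unimodal f c.
Local Notation I01 := (`[0, 1]%classic : set R).

Lemma unimodal_map {x} : I01 x -> I01 (f x).
Proof. by move=> Ix; have [[+ _ _] _] := fu; apply; exists x. Qed.

Lemma unimodal_iter n {x} : I01 x -> I01 (iter n f x).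
Proof. by move=> Ix; elim: n => //= n; exact: unimodal_map. Qed.

Lemma unimodal_c01 : I01 c.
Proof.
by have [[_ _ /andP[c0 c1]] _] := fu; rewrite /= in_itv /= !ltW.
Qed.

Lemma unimodal_incr {x y} : I01 x -> x <= y -> y <= c -> f x <= f y.
Proof.
have [[_ _ /andP[c0 c1]] [inc _]] := fu.
rewrite /= in_itv /= => /andP[x0 x1]; rewrite le_eqVlt => /predU1P[-> //|xy yc].
by apply/ltW/inc => //; rewrite in_itv /=; lra.
Qed.

Lemma unimodal_decr {x y} : I01 y -> c <= x -> x <= y -> f y <= f x.
Proof.
have [[_ _ /andP[c0 c1]] [_ dec]] := fu.
rewrite /= in_itv /= => /andP[y0 y1] cx; rewrite le_eqVlt => /predU1P[-> //|xy].
by apply/ltW/dec => //; rewrite in_itv /=; lra.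
Qed.

(** The endpoints are unordered because [f] reverses order to the right of [c]. *)
Definition between (x y z : R) := (x <= z <= y) || (y <= z <= x).

Lemma is_interval_between {A : set R} {x y z} :
  is_interval A -> A x -> A y -> between x y z -> A z.
Proof. by move=> Ai Ax Ay /orP[]; apply: Ai. Qed.

Lemma between_connected x y : connected [set z | between x y z].
Proof.
apply/connected_intervalP => u v /= xu xv z uzv; move: xu xv uzv; rewrite /between.
lra.
Qed.

Lemma between01 {x y z} : I01 x -> I01 y -> between x y z -> I01 z.
Proof. apply: is_interval_between; exact: interval_is_interval. Qed.

Lemma between_image {x y z} : I01 x -> I01 y -> between x y z ->
  ~~ (x < c < y) -> ~~ (y < c < x) -> between (f x) (f y) (f z).
Proof.
move=> Ix Iy xyz n1 n2; have Iz := between01 Ix Iy xyz.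
have [[xc yc]|[cx cy]] : (x <= c /\ y <= c) \/ (c <= x /\ c <= y).
  by move: n1 n2; case: (leP x c); case: (leP y c); lra.
  have zc : z <= c by move: xyz; rewrite /between; lra.
  by move: xyz => /orP[] /andP[h1 h2]; apply/orP; [left|right];
    rewrite !unimodal_incr.
have cz : c <= z by move: xyz; rewrite /between; lra.
by move: xyz => /orP[] /andP[h1 h2]; apply/orP; [right|left];
  rewrite !unimodal_decr.
Qed.

Lemma unimodal_same_value {y z} : I01 y -> f y <= z <= f c ->
  exists2 w, between y c w & f w = z.
Proof.
move=> Iy /andP[yz zc]; have [[_ fc _] _] := fu.
have cont a b : I01 a -> I01 b -> {within `[a, b], continuous f}.
  move=> Ia Ib; apply: continuous_subspaceW fc => w /=.
  by move: Ia Ib; rewrite /= !in_itv /=; lra.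
have [yc|cy] := leP y c.
  have [|w] := IVT yc (cont _ _ Iy unimodal_c01) (v := z).
    by rewrite ge_min le_max yz zc orbT.
  by rewrite in_itv /= => yw fw; exists w => //; rewrite /between yw.
have [|w] := IVT (ltW cy) (cont _ _ unimodal_c01 Iy) (v := z).
  by rewrite ge_min le_max yz zc orbT.
by rewrite in_itv /= => yw fw; exists w => //; rewrite /between yw orbT.
Qed.
End Unimodal.

(** * Nested central return domains and the itineraries of their shells *)

Section Shells.
Context {R : realType} (f : R -> R) (c : R) (K Y : set R).
Local Notation I01 := (`[0, 1]%classic : set R).
Local Notation Yn n := (iter n (central_return_domain f c) Y).
Local Notation pos := (position Y c).

Hypothesis fu : unimodal f c.
Hypothesis KI : K `<=` I01.
Hypothesis fK : forall x, K x -> K (f x).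
Hypothesis YI : Y `<=` I01.
Hypothesis Yi : is_interval Y.
Hypothesis Yc : Y c.
Hypothesis special : forall n, exists! C,
  component (Yn n `\` Yn n.+1) C /\ C `&` K !=set0.

Lemma iter_inK n x : K x -> K (iter n f x).
Proof. by move=> Kx; elim: n => //= n; exact: fK. Qed.

Lemma YnS_sub n : Yn n.+1 `<=` entry_domain f (Yn n) `&` Yn n.
Proof. exact: connected_component_sub. Qed.

Lemma Yn_sub {m n} : (m <= n)%N -> Yn n `<=` Yn m.
Proof.
move=> /subnK <-; elim: (n - m)%N => //= k IH x /YnS_sub[_]; exact: IH.
Qed.

Lemma Yn_sub01 {n} : Yn n `<=` I01.
Proof. exact: subset_trans (Yn_sub (leq0n n)) YI. Qed.

Lemma Yn_interval n : is_interval (Yn n).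
Proof.
by case: n => // n; apply/connected_intervalP; exact: component_connected.
Qed.

Lemma shell_meets n : exists x, K x /\ (Yn n `\` Yn n.+1) x.
Proof.
have [C [[[x _ ->] [y [yC Ky]]] _]] := special n.
by exists y; split => //; exact: connected_component_sub yC.
Qed.

(** A component taken at a point outside the set is empty, whereas every [Yn n] contains a point of
    its shell. *)
Lemma Yn_c n : Yn n c.
Proof.
have [x [_ [+ _]]] := shell_meets n; case: n => // n /= Yx.
apply: connected_component_refl; apply: contrapT => nA.
by move: Yx; rewrite /central_return_domain connected_component_out.
Qed.

(** Both points lie in the only component meeting [K]. Being an interval, it would contain [c],
    which lies in [Yn n.+1]. *)
Lemma shell_one_sided {n x y} : K x -> K y ->
  (Yn n `\` Yn n.+1) x -> (Yn n `\` Yn n.+1) y -> ~ (x < c < y).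
Proof.
move=> Kx Ky sx sy /andP[xc cy]; set A := Yn n `\` Yn n.+1 in sx sy.
have comp u : K u -> A u -> component A (connected_component A u) /\
    connected_component A u `&` K !=set0.
  move=> Ku Au; split; first by exists u.
  by exists u; split => //; exact: connected_component_refl.
have [C [_ Cu]] := special n.
have xy : connected_component A x = connected_component A y.
  by rewrite -(Cu _ (comp x Kx sx)) -(Cu _ (comp y Ky sy)).
have : connected_component A x c.
  apply: (iffLR (connected_intervalP _) (@component_connected _ A x) x y).
  - exact: connected_component_refl.
  - by rewrite xy; exact: connected_component_refl.
  - by rewrite !ltW.
by move=> /connected_component_sub[_]; apply; exact: Yn_c.
Qed.

Lemma in_shell {n x} : Y x -> ~ Yn n x ->
  exists2 m, (m < n)%N & (Yn m `\` Yn m.+1) x.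
Proof.
move=> Yx; elim: n => [//|n IH] nx; have [xn|/IH[m mn sx]] := pselect (Yn n x).
  by exists n.
by exists m => //; exact: ltnW.
Qed.

(* f ^ k is monotone between f x and f y, so Yn m, being an interval, contains
   the image of every point in between. A point z between x and c either has
   f z between f x and f y, or has the same image as some point between y and
   c; in both cases z returns to Yn m. *)
Lemma monotone_return {m k x y} : K x -> K y -> Yn m x -> Yn m.+1 y ->
  Yn m (iter k.+1 f x) -> Yn m (iter k.+1 f y) ->
  (forall i, (0 < i < k.+1)%N -> ~~ (iter i f x < c < iter i f y) /\
    ~~ (iter i f y < c < iter i f x)) ->
  Yn m.+1 x.
Proof.
move=> Kx Ky Yx Yy Ykx Yky side.
have track i w : (i <= k)%N -> between (f x) (f y) (f w) ->
    between (iter i.+1 f x) (iter i.+1 f y) (iter i.+1 f w).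
  elim: i => // i IH ik xyw; have [n1 n2] := side i.+1 ik.
  rewrite !(iterS i.+1); apply: between_image n1 n2 => //; last 1 first.
  - by apply: IH => //; exact: ltnW.
  - exact/KI/iter_inK.
  - exact/KI/iter_inK.
(* A connected set of returning points through [c] lies in the central component, which then
   contains [x]. *)
pose B := [set z | between x c z].
suff : B `<=` entry_domain f (Yn m) `&` Yn m.
  move=> BA; apply: (connected_component_max _ BA) => //.
  - by rewrite /B /= /between; lra.
  - exact: between_connected.
  - by rewrite /B /= /between; lra.
move=> z xcz.
have Ymz : Yn m z := is_interval_between (Yn_interval m) Yx (Yn_c m) xcz.
have Iz := Yn_sub01 _ Ymz; split => //; split => //.
have Ix := KI _ Kx; have Iy := KI _ Ky.
have Ic := unimodal_c01 f c fu.
have [fxz fzc] : f x <= f z /\ f z <= f c.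
  move: xcz => /orP[] /andP[h1 h2]; split.
  - exact: (unimodal_incr _ _ fu).
  - exact: (unimodal_incr _ _ fu).
  - exact: (unimodal_decr _ _ fu).
  - exact: (unimodal_decr _ _ fu).
have [fzy|/ltW fyz] := leP (f z) (f y).
  exists k.+1 => //; apply: (is_interval_between (Yn_interval m) Ykx Yky).
  by apply: track => //; rewrite /between fxz fzy.
have [|w ycw fwz] := unimodal_same_value f c fu Iy (z := f z).
  by rewrite fyz fzc.
have := is_interval_between (Yn_interval m.+1) Yy (Yn_c m.+1) ycw.
move=> /YnS_sub[[_ [[//|j] _ +]] _]; rewrite iterSr fwz -iterSr.
by exists j.+1.
Qed.

(* The key point: the sequence of positions relative to Y determines the shell.
   Follow x and y until y returns to Yn m. If the orbits lie on opposite sides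
   of c at some earlier time, then equal positions put both points in Y, and
   one-sidedness puts them in different shells, one of index less than m. *)
Lemma shell_itinerary m x y : K x -> K y ->
  (Yn m `\` Yn m.+1) x -> Yn m.+1 y ->
  exists i, pos (iter i f x) <> pos (iter i f y).
Proof.
move=> Kx Ky; elim/ltn_ind: m x y Kx Ky => m IH x y Kx Ky [Ymx nYx] Yy.
apply: contrapT => /forallNP npos.
have same i : pos (iter i f x) = pos (iter i f y).
  by apply: contrapT; exact: npos.
(* Induction hypothesis for the [i]-th iterates in either order: they share an itinerary, so a shell
   of index below [m] containing one bars the other from going deeper. *)
have shell_eq i j p q : (j < m)%N -> p = iter i f x \/ p = iter i f y ->
    q = iter i f x \/ q = iter i f y ->
    (Yn j `\` Yn j.+1) p -> ~ Yn j.+1 q.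
  move=> jm pE qE sp Yq.
  have Kpq u : u = iter i f x \/ u = iter i f y -> K u.
    by move=> [] ->; exact: iter_inK.
  have [k] := IH j jm p q (Kpq _ pE) (Kpq _ qE) sp Yq; apply.
  by case: pE qE => -> [] ->; rewrite -!iterD ?same.
have Y0 n : Yn n `<=` Y := Yn_sub (leq0n n).
have hP : exists k, `[< Yn m (iter k.+1 f y) >].
  by have [[_ [[//|k] _ Yk]] _] := YnS_sub _ _ Yy; exists k; apply/asboolP.
(* [k.+1] is the first return time of [y] to [Yn m]. *)
case: (ex_minnP hP) => k /asboolP Yky kmin.
have nYi i : (0 < i < k.+1)%N -> ~ Yn m (iter i f y).
  case: i => // i /andP[_ ik] /asboolP /kmin; lia.
apply: nYx; apply: (monotone_return Kx Ky Ymx Yy _ Yky).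
  apply: contrapT => nYkx.
  have Ykx : Y (iter k.+1 f x).
    by apply: (position_in (esym (same _))); exact: Y0 _ _ Yky.
  have [j jm sj] := in_shell Ykx nYkx.
  by apply: (shell_eq k.+1 j _ _ jm _ _ sj (Yn_sub jm _ Yky)); [left|right].
move=> i ik; set p := iter i f x; set q := iter i f y.
suff opp : ~ (p < c < q \/ q < c < p).
  by split; apply/negP => h; apply: opp; [left|right].
move=> opp.
have Yq : Y q.
  apply: contrapT => nYq; have := positionNin (esym (same i)) nYq; rewrite -/p -/q.
  by case: opp => /andP[h1 h2]; rewrite ?h1 ?h2 ltNge ltW.
have Yp : Y p := position_in (esym (same i)) Yq.
have [b bm sq] := in_shell Yq (nYi i ik).
(* With [q] in shell [b]: a deeper or shallower [p] contradicts induction, and [p] in shell [b]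
   contradicts one-sidedness. *)
have [Ybp|nYbp] := pselect (Yn b p).
  have [Ybp'|nYbp'] := pselect (Yn b.+1 p).
    by apply: (shell_eq i b q p bm _ _ sq Ybp'); [right|left].
  have sp : (Yn b `\` Yn b.+1) p by [].
  have Kp : K p := iter_inK i _ Kx; have Kq : K q := iter_inK i _ Ky.
  by case: opp; apply: (shell_one_sided (n := b)).
have [a ab sp] := in_shell Yp nYbp.
apply: (shell_eq i a p q (ltn_trans ab bm) _ _ sp); [by left|by right|].
by apply: (Yn_sub ab); case: sq.
Qed.

Lemma positions_infinite : exists z : nat -> R, (forall n, K (z n)) /\
  forall i j, (i < j)%N ->
    exists k, pos (iter k f (z i)) <> pos (iter k f (z j)).
Proof.
have /choice[z zP] := shell_meets; exists z; split => [n|i j ij].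
  by have [] := zP n.
have [Ki si] := zP i; have [Kj [Yj _]] := zP j.
exact: (shell_itinerary _ _ _ Ki Kj si (Yn_sub ij _ Yj)).
Qed.

End Shells.

(** * Minimality of the omega-limit set and the boundary of [Y] *)

Section OmegaLimit.
Context {R : realType} (f : R -> R) (c : R).
Hypothesis fu : unimodal f c.
Local Notation I01 := (`[0, 1]%classic : set R).
Local Notation K := (omega_limit f c).

Lemma omega_limit01 : K `<=` I01.
Proof.
have Icl : closed I01 by exact: interval_closed.
move=> x Kx; apply: Icl => B Bx; apply: Kx => //.
by exists 0%N => // n _; apply: unimodal_iter fu _ _ (unimodal_c01 f c fu).
Qed.

(** Restricting to [I01] reflects that [f] is continuous only relative to [0, 1]. *)
Lemma iter_continuous n x (V : set R) : I01 x -> nbhs (iter n f x) V ->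
  exists2 W, nbhs x W & forall w, W w -> I01 w -> V (iter n f w).
Proof.
have [[_ /subspace_continuousP fc _] _] := fu.
elim: n V => [|n IH] V Ix Vx; first by exists V.
have [W Wx WV] := IH _ Ix (fc _ (unimodal_iter f c fu n Ix) _ Vx).
exists W => // w Ww Iw; exact: WV Ww Iw (unimodal_iter f c fu n Iw).
Qed.

(* A boundary point of Y never returns to Y, so by minimality it cannot belong
   to the omega-limit set of c. *)
Lemma boundary_omega_limit (Y : set R) :
  minimal_set f K -> omega_limit f c c -> nice f Y -> Y c ->
  boundary01 Y `&` K = set0.
Proof.
move=> [_ Kcl fK Kmin] Kc [[G oG YE] Bn _] Yc.
rewrite -subset0 => b [Bb Kb].
(* [L] is closed and forward invariant and contains [b]; minimality would put [c] in it, although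
   [c] lies in [Y] at time 0. *)
pose L := K `&` [set x | forall n, ~ Y (iter n f x)].
suff LK : L = K by have [_ /(_ 0%N)] : L c by rewrite LK.
apply: Kmin => //; last by move=> x [].
- exists b; split => // n Yn.
  by have : (iter n f @` boundary01 Y `&` Y) (iter n f b);
    [split => //; exists b|rewrite Bn].
- rewrite closure_id; apply/seteqP; split; first exact: subset_closure.
  move=> x Lx; have Kx : K x.
    by rewrite (iffLR (closure_id _) Kcl); apply: closureS Lx => ? [].
  split=> // n; rewrite YE => -[Gx _].
  have [|W Wx WG] := iter_continuous n x G (omega_limit01 _ Kx).
    exact: open_nbhs_nbhs.
  have [w [[Kw nYw] Ww]] := Lx W Wx; apply: (nYw n).
  have Iw := omega_limit01 _ Kw.
  by rewrite YE; split; [exact: WG|exact: (unimodal_iter _ _ fu)].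
- move=> _ [x [Kx nY] <-]; split; first by apply: fK; exists x.
  by move=> n; rewrite -iterSr.
Qed.
End OmegaLimit.

Theorem corollary5p6 (R : realType) (l : R) (hl : 1 < l) :
  exists2 kappa0 : R, 0 < kappa0 &
    forall (f : R -> R) (c : R),
      classA_star f c l -> special_combinatorics f c ->
      exists2 delta : R, 0 < delta &
        forall U : set (set R),
          open_cover (omega_limit f c) U ->
          (forall A, U A -> diam A < delta) ->
          \forall n \near \oo,
            kappa0 * n%:R <= (complexity f (omega_limit f c) U n.+1)%:R.
Proof.
exists 1 => // f c [[fu _ _ _ _] _] [Kc Kmin [Y [Ynice Yi Yc _] special]].
have [_ Kcl fimK _] := Kmin; set K := omega_limit f c in Kc Kcl fimK special *.
have [Yopen _ _] := Ynice.
have fK x : K x -> K (f x) by move=> Kx; apply: fimK; exists x.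
have KI : K `<=` `[0, 1]%classic := omega_limit01 f c fu.
have YI : Y `<=` `[0, 1]%classic by case: Yopen => G _ -> x [].
have Kcompact : compact K := subclosed_compact Kcl (@segment_compact _ 0 1) KI.
have BK := boundary_omega_limit f c fu Y Kmin Kc Ynice Yc.
have [delta delta0 Kpos] := position_uniform Y K c Yopen KI Kcompact Yc BK.
have [z [zK zpos]] := positions_infinite f c K Y fu KI fK YI Yi Yc special.
exists delta => // U Ucov Udiam; near=> n; rewrite mul1r ler_nat.
have [s [ss sK us]] := morse_hedlund f K (position Y c) fK z zK zpos n.+1.
apply: (@leq_trans (size s)); first by rewrite ss ltnW.
apply: (complexity_ge f K U fK Kcompact Ucov (position Y c)) => // A UA x y Ax Ay.
have AK : A `<=` K by have [Uo _] := Ucov; have [G _ ->] := Uo _ UA => t [].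
apply: Kpos; [exact: AK|exact: AK|apply: le_lt_trans (Udiam _ UA)].
(* The supremum defining [diam] bounds distances only for a bounded set; here 1 is a bound since [A]
   lies in [0, 1]. *)
apply: ub_le_sup; last by exists x => //; exists y.
exists 1 => _ [u Au [v Av <-]]; have := KI _ (AK _ Au); have := KI _ (AK _ Av).
by rewrite /= !in_itv /= ler_norml; lra.
Unshelve. all: by end_near.
Qed.
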